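(* Let $\mathcal{C}$ be a category, $F\colon\mathcal{C}\to\mathcal{C}$ a functor, $I$ an object of $\mathcal{C}$, and $\mathcal{M}$ a class of morphisms of $\mathcal{C}$. (1) If every split monomorphism of $\mathcal{C}$ lies in $\mathcal{M}$, then every pointed $F$-coalgebra that is a tree is $\mathcal{M}$-reachably unfolded. (2) If every pointed $F$-coalgebra has some $\mathcal{M}$-reachable $\mathcal{M}$-subcoalgebra, then every $\mathcal{M}$-reachably unfolded pointed $F$-coalgebra is a tree (and in particular is also $\mathcal{M}$-reachable).
   Context: A pointed $F$-coalgebra is $(C,c,i_C)$ with $c\colon C\to FC$, $i_C\colon I\to C$; a pointed coalgebra morphism $h\colon(T,t,i_T)\to(C,c,i_C)$ is $h\colon T\to C$ with $c\cdot h=Fh\cdot t$ and $h\cdot i_T=i_C$. A split epimorphism of pointed coalgebras is a pointed coalgebra morphism $h$ for which there is a pointed coalgebra morphism $s$ with $h\cdot s=\mathrm{id}$. An $\mathcal{M}$-subcoalgebra of $(C,c,i_C)$ is a pointed coalgebra morphism into it whose underlying morphism is in $\mathcal{M}$. $(C,c,i_C)$ is $\mathcal{M}$-reachable if each of its $\mathcal{M}$-subcoalgebras is a split epimorphism of pointed coalgebras; it is a tree if every pointed coalgebra morphism into it is a split epimorphism of pointed coalgebras; it is $\mathcal{M}$-reachably unfolded if every pointed coalgebra morphism $h\colon R\to C$ from an $\mathcal{M}$-reachable pointed coalgebra $R$ is an isomorphism. *)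

(* Defs.v *)
Set Implicit Arguments.
Unset Strict Implicit.
Unset Printing Implicit Defensive.

Record category : Type := Category {
  obj :> Type;
  hom : obj -> obj -> Type;
  idm : forall X : obj, hom X X;
  comp : forall X Y Z : obj, hom Y Z -> hom X Y -> hom X Z;
  comp_idl : forall (X Y : obj) (f : hom X Y), comp (idm Y) f = f;
  comp_idr : forall (X Y : obj) (f : hom X Y), comp f (idm X) = f;
  comp_assoc : forall (W X Y Z : obj) (h : hom Y Z) (g : hom X Y) (f : hom W X),
    comp h (comp g f) = comp (comp h g) f
}.

Arguments hom {c} X Y.
Arguments idm {c} X.
Arguments comp {c X Y Z} g f.

Declare Scope cat_scope.
Delimit Scope cat_scope with cat.
Notation "g '\*' f" := (comp g f) (at level 40, left associativity) : cat_scope.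
Local Open Scope cat_scope.

Record functor (C D : category) : Type := Functor {
  fobj :> C -> D;
  fmap : forall X Y : C, hom X Y -> hom (fobj X) (fobj Y);
  fmap_id : forall X : C, fmap (idm X) = idm (fobj X);
  fmap_comp : forall (X Y Z : C) (g : hom Y Z) (f : hom X Y),
    fmap (g \* f) = fmap g \* fmap f
}.

Arguments fmap {C D} F {X Y} f : rename.

Definition mor_class (C : category) : Type :=
  forall X Y : C, hom X Y -> Prop.

Definition split_mono (C : category) (X Y : C) (m : hom X Y) : Prop :=
  exists r : hom Y X, r \* m = idm X.

Section PointedCoalgebras.

Variables (C : category) (F : functor C C) (I : C).

Record pcoalg : Type := PCoalg {
  carrier :> C;
  struct : hom carrier (F carrier);
  point : hom I carrier
}.

Record pcoalg_hom (T D : pcoalg) : Type := PCoalgHom {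
  mor :> hom T D;
  mor_struct : struct D \* mor = fmap F mor \* struct T;
  mor_point : mor \* point T = point D
}.

(* Composites are compared as morphisms of C: a pointed coalgebra morphism is
   determined by its underlying morphism. *)
Definition split_epi_pcoalg (T D : pcoalg) (h : pcoalg_hom T D) : Prop :=
  exists s : pcoalg_hom D T, h \* s = idm (carrier D).

Definition iso_pcoalg (T D : pcoalg) (h : pcoalg_hom T D) : Prop :=
  exists k : pcoalg_hom D T,
    h \* k = idm (carrier D) /\ k \* h = idm (carrier T).

Definition tree (D : pcoalg) : Prop :=
  forall (T : pcoalg) (h : pcoalg_hom T D), split_epi_pcoalg h.

Variable M : mor_class C.

Record subcoalg (D : pcoalg) : Type := SubCoalg {
  sub_dom :> pcoalg;
  sub_mor : pcoalg_hom sub_dom D;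
  sub_mor_in : M sub_mor
}.

Definition reachable (D : pcoalg) : Prop :=
  forall S : subcoalg D, split_epi_pcoalg (sub_mor S).

Definition reachably_unfolded (D : pcoalg) : Prop :=
  forall (R : pcoalg) (h : pcoalg_hom R D), reachable R -> iso_pcoalg h.

End PointedCoalgebras.

Arguments pcoalg {C} F I.

(* Main.v *)
(** (1) A section [s] of [h : R -> D] obtained from the tree property is a split
    monomorphism, hence an M-subcoalgebra of the reachable [R], hence also split
    epi; having inverses on both sides, it is inverse to [h].
    (2) Given [h : T -> D], restrict it to a reachable M-subcoalgebra
    [m : S -> T]; then [h \* m] is an isomorphism, so [h] is split epi. *)
Require Import Defs.

Local Open Scope cat_scope.

Section PointedCoalgebraMorphisms.

Variables (C : category) (F : functor C C) (I : C) (M : mor_class C).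

(** Kept transparent so that the underlying morphism of a composite computes to [g \* f]. *)
Definition pcoalg_comp (A B D : pcoalg F I)
  (g : pcoalg_hom B D) (f : pcoalg_hom A B) : pcoalg_hom A D.
Proof.
  refine (@PCoalgHom _ _ _ A D (g \* f) _ _).
  - now rewrite comp_assoc, mor_struct, <- comp_assoc, mor_struct,
      comp_assoc, <- fmap_comp.
  - now rewrite <- comp_assoc, !mor_point.
Defined.

Arguments pcoalg_comp {A B D} g f.

Lemma tree_reachable (D : pcoalg F I) : tree D -> reachable M D.
Proof. intros treeD S; apply treeD. Qed.

Lemma tree_reachably_unfolded :
  (forall (X Y : C) (m : hom X Y), split_mono m -> M X Y m) ->
  forall D : pcoalg F I, tree D -> reachably_unfolded M D.
Proof.
  intros split_mono_M D treeD R h reachR.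
  destruct (treeD R h) as [s hs].
  assert (Ms : M D R s) by (apply split_mono_M; exists h; exact hs).
  destruct (reachR (SubCoalg (sub_mor := s) Ms)) as [t st]; simpl in st.
  (* The retraction [h] and the section [t] of [s] coincide:
     [h = h \* (s \* t) = (h \* s) \* t = t]. *)
  assert (ht : mor h = mor t)
    by now rewrite <- (comp_idr h), <- st, comp_assoc, hs, comp_idl.
  exists s; split; [exact hs | now rewrite ht].
Qed.

Lemma reachably_unfolded_tree :
  (forall D : pcoalg F I, exists S : subcoalg M D, reachable M S) ->
  forall D : pcoalg F I, reachably_unfolded M D -> tree D.
Proof.
  intros has_reachable D unfD T h.
  destruct (has_reachable T) as [S reachS].
  destruct (unfD S (pcoalg_comp h (sub_mor S)) reachS) as [k [hmk _]].
  (* As [k] inverts [h \* sub_mor S], reassociating makes [sub_mor S \* k] a section of [h]. *)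
  exists (pcoalg_comp (sub_mor S) k); simpl in *.
  now rewrite comp_assoc.
Qed.

End PointedCoalgebraMorphisms.

Theorem theorem5p5 (C : category) (F : functor C C) (I : C) (M : mor_class C) :
  ((forall (X Y : C) (m : hom X Y), split_mono m -> M X Y m) ->
   forall D : pcoalg F I, tree D -> reachably_unfolded M D)
  /\
  ((forall D : pcoalg F I, exists S : subcoalg M D, reachable M S) ->
   forall D : pcoalg F I, reachably_unfolded M D -> tree D /\ reachable M D).
Proof.
  split; [apply tree_reachably_unfolded |].
  intros has_reachable D unfD.
  assert (treeD : tree D) by exact (reachably_unfolded_tree C F I M has_reachable D unfD).
  split; [exact treeD | now apply tree_reachable].
Qed.
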